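(* For $n\geq 1$, the number $t_n(132)$ of permutations $\pi\in\mathcal{S}_n$ such that both $\pi$ and $\theta(\pi)$ avoid $132$ equals $\sum_{k=0}^{n+1} F_{n+1-k}F_k$, where $F_m$ is the $m$-th Fibonacci number. Equivalently, $\sum_{n\ge 1} t_n(132)x^n = \dfrac{x}{(1-x-x^2)^2}$.
   Context: $\mathcal{S}_n$ is the symmetric group on $[n]$, permutations in one-line notation $\pi_1\cdots\pi_n$. A permutation avoids a pattern $\tau$ if it has no subsequence order-isomorphic to $\tau$. The standard cycle notation of $\pi$ writes each cycle (fixed points included) with its largest element first and orders cycles by increasing largest element. The fundamental bijection $\theta:\mathcal{S}_n\to\mathcal{S}_n$ maps $\pi$ to the permutation whose one-line notation is obtained by erasing the parentheses of the standard cycle notation of $\pi$. Fibonacci numbers: $F_0=0$, $F_1=F_2=1$, $F_{m}=F_{m-1}+F_{m-2}$. *)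

(* Defs.v *)
From HB Require Import structures.
From mathcomp Require Import all_boot all_order all_algebra all_fingroup.

Set Implicit Arguments.
Unset Strict Implicit.
Unset Printing Implicit Defensive.

Import GRing.Theory.

(* [n] is represented by 'I_n = {0, ..., n-1}. Pattern containment only depends
   on the relative order of the letters, so this shift is harmless, and patterns
   can be written with their usual letters. *)
Definition one_line n (pi : 'S_n) : seq nat := [seq val (pi i) | i <- enum 'I_n].

Definition order_isomorphic (s t : seq nat) : bool :=
  (size s == size t) &&
  [forall i : 'I_(size s), forall j : 'I_(size s),
     (nth 0 s i < nth 0 s j) == (nth 0 t i < nth 0 t j)].

(* The subsequences of s are the words mask m s, with m a bit vector. *)
Definition contains (tau s : seq nat) : bool :=
  [exists m : (size s).-tuple bool, order_isomorphic (mask m s) tau].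

Definition avoids (tau : seq nat) n (pi : 'S_n) : bool :=
  ~~ contains tau (one_line pi).

Definition cycle_max n (pi : 'S_n) (x : 'I_n) : bool :=
  [forall y in porbit pi x, y <= x].

(* As enum 'I_n is increasing, the cycles are listed by increasing largest
   element; the cycle with largest element x is x, pi x, pi (pi x), ... *)
Definition standard_cycles n (pi : 'S_n) : seq (seq 'I_n) :=
  [seq traject pi x #|porbit pi x| | x <- enum 'I_n & cycle_max pi x].

Definition cycle_word n (pi : 'S_n) : seq 'I_n := flatten (standard_cycles pi).

Lemma cycle_max_inj n (pi : 'S_n) (x y z : 'I_n) :
  cycle_max pi x -> cycle_max pi y ->
  z \in porbit pi x -> z \in porbit pi y -> x = y.
Proof.
move=> /forall_inP mx /forall_inP my zx zy.
have exy : porbit pi x = porbit pi y.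
  move: zx zy; rewrite -!eq_porbit_mem => /eqP <- /eqP <- //.
apply/val_inj/eqP; rewrite eqn_leq my ?mx //.
- by rewrite exy porbit_id.
- by rewrite -exy porbit_id.
Qed.

Lemma cycle_word_uniq n (pi : 'S_n) : uniq (cycle_word pi).
Proof.
have -> : cycle_word pi = [seq y | x <- [seq x <- enum 'I_n | cycle_max pi x],
                                   y <- traject pi x #|porbit pi x|].
  by rewrite /cycle_word /standard_cycles; congr flatten;
     apply: eq_map => x; rewrite map_id.
apply: allpairs_uniq_dep; first by rewrite filter_uniq ?enum_uniq.
- by move=> x _; apply: uniq_traject_porbit.
move=> p q /allpairsPdep [x] [u] [xl ux ->] /allpairsPdep [y] [v] [yl vy ->] /= uv.
subst v; move: xl yl; rewrite !mem_filter => /andP[mx _] /andP[my _].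
by rewrite -!porbit_traject in ux vy; rewrite (cycle_max_inj mx my ux vy).
Qed.

Lemma mem_cycle_word n (pi : 'S_n) (x : 'I_n) : x \in cycle_word pi.
Proof.
have [m mx mP] := @arg_maxnP _ x (mem (porbit pi x)) val (porbit_id pi x).
have mE : porbit pi m = porbit pi x by apply/eqP; rewrite eq_porbit_mem.
apply/flattenP; exists (traject pi m #|porbit pi m|).
  apply: map_f; rewrite mem_filter mem_enum andbT.
  by apply/forall_inP => y; rewrite mE => /mP.
by rewrite -porbit_traject mE porbit_id.
Qed.

Lemma size_cycle_word n (pi : 'S_n) : size (cycle_word pi) = n.
Proof.
rewrite -(card_uniqP (cycle_word_uniq pi)) -[RHS]card_ord.
by apply: eq_card => x; rewrite mem_cycle_word.
Qed.

Lemma theta_subproof n (pi : 'S_n) :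
  injective (fun i : 'I_n => nth i (cycle_word pi) i).
Proof.
move=> i j /=; rewrite (set_nth_default i j) ?size_cycle_word // => /eqP.
by rewrite nth_uniq ?size_cycle_word ?cycle_word_uniq // => /eqP /val_inj.
Qed.

Definition theta n (pi : 'S_n) : 'S_n := perm (@theta_subproof n pi).

Lemma one_line_theta n (pi : 'S_n) :
  one_line (theta pi) = [seq val x | x <- cycle_word pi].
Proof.
apply: (@eq_from_nth _ 0).
  by rewrite (size_map _ (enum _)) (size_map _ (cycle_word _)) size_enum_ord size_cycle_word.
move=> i; rewrite (size_map _ (enum _)) size_enum_ord => lt_in.
rewrite (@nth_map _ (Ordinal lt_in) _ _ _ _ (enum 'I_n)) ?size_enum_ord // permE.
rewrite (@nth_map _ (Ordinal lt_in) _ _ _ _ (cycle_word pi)) ?size_cycle_word //.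
apply: (congr1 val); rewrite nth_enum_ord //.
by apply: set_nth_default; rewrite size_cycle_word.
Qed.

Definition t_num (tau : seq nat) (n : nat) : nat :=
  #|[set pi : 'S_n | avoids tau pi && avoids tau (theta pi)]|.

Fixpoint fib (n : nat) : nat :=
  match n with
  | 0 => 0
  | n'.+1 => if n' is n''.+1 then fib n' + fib n'' else 1
  end.

(* Formal power series over a field, given by their coefficients. *)
Section PowerSeries.
Variable F : fieldType.
Local Open Scope ring_scope.

Definition fps := nat -> F.

Definition fps_of_poly (p : {poly F}) : fps := fun n => p`_n.

Definition fps_mul (f g : fps) : fps :=
  fun n => \sum_(i < n.+1) f i * g (n - i)%N.

(* The first n+1 coefficients b_0, ..., b_n of 1/f, from b_0 = 1/f_0 and
   f_0 b_m + f_1 b_(m-1) + ... + f_m b_0 = 0 for m > 0. *)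
Fixpoint fps_inv_seq (f : fps) (n : nat) : seq F :=
  if n is m.+1 then
    let b := fps_inv_seq f m in
    rcons b (- (f 0)^-1 * \sum_(i < m.+1) f i.+1 * b`_(m - i))
  else [:: (f 0)^-1].

Definition fps_inv (f : fps) : fps := fun n => (fps_inv_seq f n)`_n.

Definition fps_div (f g : fps) : fps := fps_mul f (fps_inv g).

Lemma size_fps_inv_seq (f : fps) n : size (fps_inv_seq f n) = n.+1.
Proof. by elim: n => //= n IHn; rewrite size_rcons IHn. Qed.

Lemma fps_inv_seqE (f : fps) n k : (k <= n)%N -> (fps_inv_seq f n)`_k = fps_inv f k.
Proof.
elim: n => [|n IHn]; first by rewrite leqn0 => /eqP ->.
rewrite leq_eqVlt => /orP[/eqP -> //|]; rewrite ltnS => le_kn /=.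
by rewrite nth_rcons size_fps_inv_seq ltnS le_kn IHn.
Qed.

Lemma fps_mulV (f : fps) : f 0 != 0 -> fps_mul f (fps_inv f) =1 fps_of_poly 1.
Proof.
move=> f0 [|n]; rewrite /fps_mul /fps_of_poly coef1.
  by rewrite big_ord1 /fps_inv /= divff.
rewrite big_ord_recl /= subn0 {1}/fps_inv /= nth_rcons size_fps_inv_seq ltnn eqxx.
rewrite mulrA mulrN divff // mulN1r; apply/eqP; rewrite addrC subr_eq0; apply/eqP.
apply: eq_bigr => i _.
by rewrite fps_inv_seqE ?leq_subr // /bump /= add1n subSS.
Qed.

End PowerSeries.

(* Main.v *)
Require Import Defs.
From mathcomp Require Import all_boot all_order all_algebra all_fingroup.
From mathcomp Require Import zify ring.

(** Let [w] be the word of [theta pi]; then [pi x] is the minimum of the letter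
  following [x] in [w] and of the largest letter of [w] up to [x], so the
  permutations can be counted through their words. Write [N] for the largest
  letter of [w = L N R]; avoidance in [w] puts the letters of [L] above those
  of [R].

  If [L] is not empty, then avoidance in [pi] forces [R] to be empty or to be
  the single letter [0], and [L] is then, up to a shift of its letters, an
  arbitrary word of the same kind of length [n - 1] or [n - 2].
  If [L] is empty, then [pi] is a single cycle, and [w] is either
  [N 0 1 ... (N-1)], or ends in [0]. In the latter case either [N - 1] follows [N],
  and deleting [N] leaves a cyclic word ending in [0], or [w] ends
  in [(N-1) 0], and deleting these two letters leaves any cyclic word. Hence
  the cyclic words are counted by the Fibonacci numbers, and
  [t_n = t_(n-1) + t_(n-2) + F_n]. *)

Set Implicit Arguments.
Unset Strict Implicit.
Unset Printing Implicit Defensive.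

(** * Avoidance of 132 *)

(** Recursion on the first letter, as the possible 1 of a pattern, makes the test computable and
    easy to follow when letters are added at either end. *)
Fixpoint av132 (s : seq nat) : bool :=
  if s is a :: s' then pairwise (fun b c => ~~ (a < c < b)) s' && av132 s'
  else true.

Lemma pairwise_subseqP (r : rel nat) (s : seq nat) :
  reflect (forall b c, subseq [:: b; c] s -> r b c) (pairwise r s).
Proof.
apply: (iffP idP) => [rs b c /subseq_pairwise/(_ rs)|].
  by rewrite pairwise2.
elim: s => //= a s IHs rs; rewrite IHs ?andbT => [|b c bc]; last first.
  by apply: rs; case: eqP => // _; apply: subseq_trans bc; apply: subseq_cons.
by apply/allP => c cs; apply: rs; rewrite eqxx sub1seq.
Qed.

Lemma av132P s :
  reflect (forall a b c, subseq [:: a; b; c] s -> ~~ (a < c < b)) (av132 s).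
Proof.
elim: s => [|x s IHs] /=; first by constructor.
apply: (iffP andP) => [[/pairwise_subseqP ps /IHs avs] a b c|avs].
  by case: eqP => [->|_]; [apply: ps | apply: avs].
split; first by apply/pairwise_subseqP => b c bc; apply: avs; rewrite eqxx.
apply/IHs => a b c abc; apply: avs; case: eqP => // _.
by apply: subseq_trans abc; apply: subseq_cons.
Qed.

(** A first letter can only be the 1 of an occurrence, and a maximal letter cannot be. *)
Lemma av132_cons_max a s : all (leq^~ a) s -> av132 (a :: s) = av132 s.
Proof.
move=> /allP mx /=; rewrite (_ : pairwise _ s) //; apply/pairwise_subseqP => b c.
by move/mem_subseq/(_ c); rewrite !inE eqxx orbT => /(_ isT)/mx /=; lia.
Qed.

Lemma av132_rcons_max b s : all (leq^~ b) s -> av132 (rcons s b) = av132 s.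
Proof.
elim: s => //= a s IHs /andP[_ mx]; rewrite IHs // pairwise_rcons.
rewrite (_ : all _ s) //; apply/allP => c /(allP mx) /=; lia.
Qed.

(** A last letter can only be the 2, which needs a smaller letter before it. *)
Lemma av132_rcons_min b s : all (leq b) s -> av132 (rcons s b) = av132 s.
Proof.
elim: s => //= a s IHs /andP[ba mn]; rewrite IHs // pairwise_rcons.
rewrite (_ : all _ s) //; apply/allP => c _ /=; lia.
Qed.

Lemma av132_map_succ s : av132 (map succn s) = av132 s.
Proof. by elim: s => //= a s ->; rewrite pairwise_map. Qed.

(** The letter 0 is too small to be the 3 or the 2, and with one letter after it it cannot be the
    1. *)
Lemma av132_cat0 s b : av132 (s ++ [:: 0; b]) = av132 (rcons s b).
Proof.
elim: s => [|a s IHs] //=.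
rewrite IHs pairwise_cat pairwise_rcons; congr (_ && _).
rewrite pairwise2 andbF /= andbT; congr (_ && _).
rewrite /allrel; apply: eq_all => c /=; lia.
Qed.

Lemma av132_iota m n : av132 (iota m n).
Proof.
elim: n => // n IHn; rewrite -addn1 iotaD cats1 av132_rcons_max //.
by apply/allP => x; rewrite mem_iota; lia.
Qed.

Lemma av132_mkseq (f : nat -> nat) n i j k : av132 (mkseq f n) ->
  i < j -> j < k -> k < n -> ~~ (f i < f k < f j).
Proof.
move=> /av132P avf ij jk kn; apply: avf.
suff /(map_subseq f) : subseq [:: i; j; k] (iota 0 n) by [].
suff -> : [:: i; j; k] = [seq x <- iota 0 n | x \in [:: i; j; k]].
  exact: filter_subseq.
apply: (irr_sorted_eq ltn_trans ltnn); first by rewrite /= ij jk.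
  by apply: sorted_filter; [exact: ltn_trans | exact: iota_ltn_sorted].
move=> x; rewrite mem_filter mem_iota !inE; lia.
Qed.

Lemma contains132 s : contains [:: 1; 3; 2] s = ~~ av132 s.
Proof.
apply/existsP/idP => [[m /andP[/eqP sz /forallP iso]]|/av132P nav].
  have /= := mask_subseq m s.
  move: sz iso; case: (mask m s) => [|a [|b [|c [|]]]] // _ iso abc.
  apply: contraTN (isT) => /av132P/(_ _ _ _ abc).
  (* Two comparisons suffice: positions 0, 2 give [a < c] and positions 2, 1 give [c < b]. *)
  have := forallP (iso (@Ordinal 3 0 isT)) (@Ordinal 3 2 isT).
  have := forallP (iso (@Ordinal 3 2 isT)) (@Ordinal 3 1 isT).
  by rewrite /= => /eqP -> /eqP ->.
case: (boolP [exists m : (size s).-tuple bool,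
         order_isomorphic (mask m s) [:: 1; 3; 2]]) => [/existsP//|/existsPn no].
case: nav => a b c /subseqP[m sm mE]; apply/negP => /andP[ac cb].
have /negP := no (@Tuple _ _ m (introT eqP sm)); apply.
rewrite /order_isomorphic /= -mE /=.
apply/forallP => -[[|[|[|//]]] /= ?]; apply/forallP => -[[|[|[|//]]] /= ?]; lia.
Qed.

(** * Recovering a permutation from its cycle word *)

(** A plain fold, so that small cases can be settled by computation. *)
Definition maxs : seq nat -> nat := foldr maxn 0.

Lemma maxsE s : maxs s = \max_(y <- s) y.
Proof. exact: foldrE. Qed.

Lemma leq_maxs y s : y \in s -> y <= maxs s.
Proof. by rewrite maxsE => ys; apply: (@leq_bigmax_seq _ s xpredT id). Qed.

Lemma maxs_eq m s : m \in s -> all (leq^~ m) s -> maxs s = m.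
Proof.
move=> ms /allP mx; apply/eqP; rewrite eqn_leq; apply/andP; split.
  by rewrite maxsE; apply/bigmax_leqP_seq => y /mx.
exact: leq_maxs.
Qed.

Lemma maxs_mem x s : maxs (x :: s) \in x :: s.
Proof.
elim: s x => [|y s IHs] x; first by rewrite /= maxn0 mem_head.
rewrite [maxs _]/= -/(maxs (y :: s)) /maxn.
by case: ifP => _; rewrite ?mem_head // in_cons IHs orbT.
Qed.

Lemma maxs_map_succ x s : maxs (map succn (x :: s)) = (maxs (x :: s)).+1.
Proof.
apply: maxs_eq; first by rewrite (mem_map succn_inj) maxs_mem.
rewrite all_map; apply/allP => y ys; exact: leq_maxs ys.
Qed.

(* If [w] is the cycle word of [pi], then [pi x = nxt w x]: the maximum of the
   letters up to [x] is the largest element of the cycle of [x], and the letter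
   following [x] exceeds it exactly when it opens a new cycle. *)
Definition nxt (w : seq nat) (x : nat) : nat :=
  let i := (index x w).+1 in
  let m := maxs (take i w) in minn m (nth m w i).

Lemma nxt_cat u x y v : x \notin u ->
  nxt (u ++ x :: y :: v) x = minn (maxs (rcons u x)) y.
Proof.
move=> xu; rewrite /nxt index_cat (negPf xu) /= eqxx addn0 -cat_rcons.
by rewrite take_size_cat ?size_rcons // nth_cat size_rcons ltnn subnn.
Qed.

(** No letter follows [x], so [nth] returns its default, which is the running maximum itself: the
    last cycle closes. *)
Lemma nxt_rcons u x : x \notin u -> nxt (rcons u x) x = maxs (rcons u x).
Proof.
move=> xu; rewrite /nxt -cats1 index_cat (negPf xu) /= eqxx addn0 cats1.
by rewrite take_oversize ?nth_default ?size_rcons //; apply/minn_idPl.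
Qed.

Lemma nxt_mem w x : uniq w -> x \in w -> nxt w x \in w.
Proof.
move=> + /splitPr xw; case: xw => u v.
have m_in : maxs (rcons u x) \in rcons u x.
  by case: u => [|z u]; rewrite ?rcons_cons; exact: maxs_mem.
have m_in' : maxs (rcons u x) \in u ++ x :: v by rewrite -cat_rcons mem_cat m_in.
rewrite cat_uniq => /and3P[_ /norP[xu _] _].
case: v m_in' => [|y v] m_in'; first by rewrite cats1 nxt_rcons // -cats1.
rewrite nxt_cat // /minn; case: ifP => // _.
by rewrite mem_cat !inE eqxx !orbT.
Qed.

(** Only the last letter of [u] sees [N], and as [N] is at least the running maximum, the minimum is
    unchanged. *)
Lemma nxt_catl u N v x : uniq u -> all (leq^~ N) u -> x \in u ->
  nxt (u ++ N :: v) x = nxt u x.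
Proof.
move=> + + /splitPr xu; case: xu => p q; rewrite cat_uniq.
case: q => [|y q] /and3P[_ /norP[xp _] _] uN; last by rewrite -catA /= !nxt_cat.
rewrite -catA /= nxt_cat // cats1 nxt_rcons //; apply/minn_idPl; rewrite maxsE.
apply/bigmax_leqP_seq => z; rewrite -cats1 => zp _.
by apply: (allP uN).
Qed.

Lemma nxt_next u x y v N : x \notin u -> N \in rcons u x ->
  all (leq^~ N) (rcons u x) -> y <= N -> nxt (u ++ x :: y :: v) x = y.
Proof. by move=> xu Nu uN yN; rewrite nxt_cat // (maxs_eq Nu uN); apply/minn_idPr. Qed.

Lemma nxt_close u x N : x \notin u -> N \in rcons u x ->
  all (leq^~ N) (rcons u x) -> nxt (rcons u x) x = N.
Proof. by move=> xu Nu uN; rewrite nxt_rcons // (maxs_eq Nu uN). Qed.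

Lemma nxt_map_succ w x : x \in w -> uniq w ->
  nxt (map succn w) x.+1 = (nxt w x).+1.
Proof.
move=> /splitPr xw; case: xw => u v; rewrite cat_uniq => /and3P[_ /norP[xu _] _].
have xu' : x.+1 \notin map succn u by rewrite (mem_map succn_inj).
have E : maxs (rcons (map succn u) x.+1) = (maxs (rcons u x)).+1.
  by rewrite -map_rcons; case: u {xu xu'} => [|y u]; rewrite ?rcons_cons maxs_map_succ.
case: v => [|y v]; first by rewrite cats1 map_rcons !nxt_rcons.
rewrite map_cat /= !nxt_cat // E; lia.
Qed.

(** Earlier cycles have smaller letters, so the running maximum at [x] is the leader [N] of its
    cycle. Inside the cycle the next letter is [pi x]; at its end comes a larger leader or nothing,
    and [pi x = N]. *)
Lemma nxt_cycle_word n (pi : 'S_n) (x : 'I_n) :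
  nxt [seq val y | y <- cycle_word pi] x = pi x.
Proof.
have [N [ms1 [ms2 [msE mN xN]]]] : exists N ms1 ms2,
    [/\ [seq y <- enum 'I_n | cycle_max pi y] = ms1 ++ N :: ms2,
        cycle_max pi N & x \in porbit pi N].
  have /flattenP[_ /mapP[N Nm ->]] := mem_cycle_word pi x.
  rewrite -porbit_traject => xN; have := Nm.
  rewrite mem_filter => /andP[mN _]; move: Nm.
  by case/splitPr => p q; exists N, p, q.
have maxN z y : cycle_max pi z -> y \in traject pi z #|porbit pi z| -> y <= z.
  by move=> /forall_inP mz; rewrite -porbit_traject => /mz.
have srt : sorted (fun i j : 'I_n => i < j) (ms1 ++ N :: ms2).
  rewrite -msE; apply: sorted_filter; first by move=> a b c; apply: ltn_trans.
  by have := iota_ltn_sorted 0 n; rewrite -val_enum_ord sorted_map.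
have msM z : z \in ms1 ++ N :: ms2 -> cycle_max pi z.
  by rewrite -msE mem_filter => /andP[].
pose tr y := traject pi y #|porbit pi y|.
have wE : cycle_word pi = flatten (map tr ms1) ++ tr N ++ flatten (map tr ms2).
  by rewrite /cycle_word /standard_cycles msE map_cat flatten_cat.
have := cycle_word_uniq pi; rewrite wE => uw.
have lt_pw := srt; rewrite sorted_pairwise in lt_pw; last first.
  by move=> a b c; apply: ltn_trans.
move: lt_pw; rewrite pairwise_cat => /and3P[/allrelP lt12 _ /= /andP[/allP lt2 _]].
have U_le y : y \in flatten (map tr ms1) -> y <= N.
  case/flattenP => _ /mapP[z z1 ->] /maxN yz.
  apply: leq_trans (ltnW (lt12 z N z1 (mem_head _ _))).
  by apply: yz; apply: msM; rewrite mem_cat z1.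
have T_le y : y \in tr N -> y <= N by apply: maxN.
have Nt : N \in tr N by rewrite -porbit_traject porbit_id.
have xt : x \in tr N by rewrite -porbit_traject.
have uUT : uniq (flatten (map tr ms1) ++ tr N).
  by move: uw; rewrite catA cat_uniq => /and3P[].
have -> : nxt [seq val y | y <- flatten (map tr ms1) ++ tr N ++ flatten (map tr ms2)] x
        = nxt [seq val y | y <- flatten (map tr ms1) ++ tr N] x.
  case: ms2 lt2 {msE srt msM wE lt12 uw} => [|z ms2] lt2; first by rewrite /= cats0.
  have -> : flatten (map tr (z :: ms2))
          = z :: traject pi (pi z) #|porbit pi z|.-1 ++ flatten (map tr ms2).
    by rewrite /= /tr; case: #|_| (card_porbit_neq0 pi z).
  rewrite catA map_cat /= nxt_catl //.
  - by rewrite map_inj_uniq //; apply: val_inj.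
  - rewrite all_map; apply/allP => y /=; rewrite mem_cat => yUT.
    apply: (@leq_trans N); last by apply: ltnW; apply: lt2; rewrite mem_head.
    by case/orP: yUT => [/U_le|/T_le].
  - by rewrite map_f // mem_cat xt orbT.
have trE : tr N = N :: traject pi (pi N) #|porbit pi N|.-1.
  by rewrite /tr; case: #|_| (card_porbit_neq0 pi N).
(* In the trajectory of [N] each letter is followed by its image, and the last one is mapped back to
   [N]. *)
have fp : forall p q, tr N = p ++ x :: q ->
    if q is z :: q' then z = pi x else pi x = N.
  move=> p q tE.
  have : fpath pi N (traject pi (pi N) #|porbit pi N|.-1) by apply: fpath_traject.
  have : last N (traject pi (pi N) #|porbit pi N|.-1) = iter #|porbit pi N|.-1 pi N.
    by rewrite last_traject.
  have {}tE := etrans (esym trE) tE.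
  case: q tE => [|z q] tE; last first.
    move=> _; case: p tE => [[-> ->] /= /andP[/eqP] //|a p [_ ->]].
    by rewrite cat_path /= => /and3P[_ _ /andP[/eqP]].
  move=> lastE _; have := congr1 (last N) tE; rewrite /= lastE last_cat /= => <-.
  by rewrite -iterS prednK ?iter_porbit // lt0n card_porbit_neq0.
case/splitPr E: {1}(tr N) / xt => [p q].
have fpq := fp _ _ E; have headE := etrans (esym E) trE.
rewrite {}E in uUT T_le Nt *.
have xU : val x \notin [seq val y | y <- flatten (map tr ms1) ++ p].
  rewrite mem_map; last exact: val_inj.
  by move: uUT; rewrite catA cat_uniq => /and3P[_ /norP[]].
have Nin : val N \in rcons [seq val y | y <- flatten (map tr ms1) ++ p] (val x).
  rewrite -map_rcons map_f //.
  by case: p headE {xU fpq uUT T_le Nt} => [|a p] [-> _];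
    rewrite mem_rcons !inE ?mem_cat ?mem_head ?eqxx ?orbT.
have allN : all (leq^~ (val N)) (rcons [seq val y | y <- flatten (map tr ms1) ++ p] (val x)).
  rewrite -map_rcons all_map; apply/allP => y /=; rewrite rcons_cat mem_cat.
  case/orP => [/U_le //|yp]; apply: T_le.
  by rewrite -cat_rcons mem_cat yp.
rewrite catA map_cat.
case: q T_le fpq {uUT Nt fp headE} => [|z q] T_le fpq /=.
  by rewrite cats1 fpq; apply: nxt_close.
rewrite -fpq; apply: nxt_next Nin allN _ => //.
by apply: T_le; rewrite mem_cat !inE eqxx !orbT.
Qed.

(** * Words of permutations *)

Lemma perm_one_line n (pi : 'S_n) : perm_eq (one_line pi) (iota 0 n).
Proof.
apply: uniq_perm; rewrite ?iota_uniq //.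
  by rewrite map_inj_uniq ?enum_uniq // => i j /val_inj/perm_inj.
move=> k; rewrite mem_iota add0n; apply/mapP/idP => [[i _ ->]|kn].
  exact: ltn_ord.
exists ((pi^-1)%g (Ordinal kn)); first by rewrite mem_enum.
by rewrite permKV.
Qed.

Lemma one_line_nxt n (pi : 'S_n) :
  one_line pi = mkseq (nxt (one_line (theta pi))) n.
Proof.
rewrite one_line_theta /mkseq -val_enum_ord -map_comp.
by apply: eq_map => i /=; rewrite nxt_cycle_word.
Qed.

Lemma one_line_theta_inj n : injective (fun pi : 'S_n => one_line (theta pi)).
Proof.
move=> p q /= E; have : one_line p = one_line q by rewrite (one_line_nxt p) E -one_line_nxt.
by move=> /eq_in_map pq; apply/permP => i; apply/val_inj/pq; rewrite mem_enum.
Qed.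

(* For [w = one_line (theta pi)] the second word is [one_line pi]. *)
Definition good (w : seq nat) : bool :=
  av132 w && av132 (mkseq (nxt w) (size w)).

Definition good_words n := [seq w <- permutations (iota 0 n) | good w].

(** The words of [theta pi] are pairwise distinct and [n!] in number, so they are all the
    arrangements of [iota 0 n]. *)
Lemma t_num132E n : t_num [:: 1; 3; 2] n = size (good_words n).
Proof.
have pE : perm_eq [seq one_line (theta pi) | pi <- enum 'S_n]
                  (permutations (iota 0 n)).
  have un : uniq [seq one_line (theta pi) | pi <- enum 'S_n].
    by rewrite map_inj_uniq ?enum_uniq //; apply: one_line_theta_inj.
  apply: uniq_perm; rewrite ?permutations_uniq //.
  apply: (uniq_min_size un _ _).2 => [w /mapP[pi _ ->]|].
    by rewrite mem_permutations perm_one_line.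
  rewrite size_map -cardE card_Sn size_permutations ?iota_uniq //.
  by rewrite size_iota.
rewrite size_filter -(seq.permP pE) count_map /t_num cardsE cardE.
rewrite {1}/enum_mem size_filter -enumT; apply: eq_count => pi /=.
rewrite unfold_in /avoids !contains132 !negbK /good andbC (one_line_nxt pi).
by rewrite (perm_size (perm_one_line _)) size_iota.
Qed.

Lemma mkseq_recl (T : Type) (f : nat -> T) n :
  mkseq f n.+1 = f 0 :: mkseq (fun i => f i.+1) n.
Proof. by rewrite /mkseq /= -(addn0 1) iotaDl -map_comp. Qed.

Lemma eq_in_mkseq (T : Type) (f g : nat -> T) n :
  (forall i, i < n -> f i = g i) -> mkseq f n = mkseq g n.
Proof.
move=> fg; rewrite /mkseq -val_enum_ord -!map_comp.
by apply: eq_map => i /=; apply: fg.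
Qed.

Section PermIota.
Variables (n : nat) (w : seq nat).
Hypothesis wn : perm_eq w (iota 0 n).

Lemma perm_iota_size : size w = n.
Proof. by rewrite (perm_size wn) size_iota. Qed.

Lemma perm_iota_uniq : uniq w.
Proof. by rewrite (perm_uniq wn) iota_uniq. Qed.

Lemma perm_iota_mem x : (x \in w) = (x < n).
Proof. by rewrite (perm_mem wn) mem_iota. Qed.

Lemma perm_iota_nxt x : x < n -> nxt w x < n.
Proof. by rewrite -!perm_iota_mem; apply: nxt_mem; apply: perm_iota_uniq. Qed.

Lemma perm_iota_mkseq_lt : all (gtn n) (mkseq (nxt w) n).
Proof.
by apply/allP => _ /mapP[x + ->]; rewrite mem_iota => /perm_iota_nxt.
Qed.

End PermIota.

Lemma perm_iota_rcons v n :
  perm_eq (rcons v n) (iota 0 n.+1) = perm_eq v (iota 0 n).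
Proof. by rewrite -addn1 iotaD cats1 perm_rcons perm_sym perm_rcons perm_cons perm_sym. Qed.

Lemma perm_iota_cons v n :
  perm_eq (n :: v) (iota 0 n.+1) = perm_eq v (iota 0 n).
Proof. by rewrite -(perm_iota_rcons v n) perm_rcons. Qed.

Lemma perm_iota_map_succ v n :
  perm_eq (rcons (map succn v) 0) (iota 0 n.+1) = perm_eq v (iota 0 n).
Proof.
rewrite perm_rcons /= perm_cons -(addn0 1) iotaDl.
by apply/idP/idP => [/perm_map_inj|/perm_map]; apply; apply: succn_inj.
Qed.

Lemma perm_iota_map_cat v n :
  perm_eq (map succn v ++ [:: n.+1; 0]) (iota 0 n.+2) = perm_eq v (iota 0 n).
Proof.
rewrite -(perm_iota_rcons v n) -(perm_iota_map_succ (rcons v n)).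
by rewrite map_rcons -cat_rcons cats1.
Qed.

(** The new letter is a fixed point, so each of the two words only gains a maximal last letter. *)
Lemma good_rcons v n : perm_eq v (iota 0 n) -> good (rcons v n) = good v.
Proof.
move=> vn; have vlt : all (leq^~ n) v.
  by apply/allP => x; rewrite (perm_iota_mem vn) => /ltnW.
have nv : n \notin v by rewrite (perm_iota_mem vn) ltnn.
rewrite /good av132_rcons_max // size_rcons (perm_iota_size vn) mkseqS.
rewrite (@nxt_close _ _ n) ?mem_rcons ?mem_head ?all_rcons ?leqnn //.
have -> : mkseq (nxt (rcons v n)) n = mkseq (nxt v) n.
  apply: eq_in_mkseq => i i_n.
  by rewrite -cats1 nxt_catl ?(perm_iota_uniq vn) ?(perm_iota_mem vn).
rewrite av132_rcons_max //.
by apply: sub_all (perm_iota_mkseq_lt vn) => x /ltnW.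
Qed.

(** The two new letters form a 2-cycle. Hence the word of the permutation is the shifted old one
    between a maximal first letter and a final 0. *)
Lemma good_map_cat v n : perm_eq v (iota 0 n) ->
  good (map succn v ++ [:: n.+1; 0]) = good v.
Proof.
move=> vn; set w := _ ++ _.
have wn : perm_eq w (iota 0 n.+2) by rewrite perm_iota_map_cat.
have vle : all (leq^~ n.+1) (map succn v).
  by rewrite all_map; apply/allP => x /=; rewrite (perm_iota_mem vn); lia.
have nv : n.+1 \notin map succn v.
  by rewrite (mem_map succn_inj) (perm_iota_mem vn) ltnn.
have z0 : 0 \notin rcons (map succn v) n.+1.
  by rewrite mem_rcons inE /=; apply/mapP => -[].
rewrite /good (perm_iota_size wn) mkseqS mkseq_recl.
have -> : nxt w n.+1 = 0.
  by apply: (@nxt_next _ _ _ _ n.+1); rewrite ?mem_rcons ?mem_head ?all_rcons ?leqnn.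
have -> : nxt w 0 = n.+1.
  rewrite /w -cat_rcons cats1; apply: nxt_close => //.
    by rewrite !mem_rcons inE mem_rcons mem_head orbT.
  by rewrite !all_rcons leqnn.
have -> : mkseq (fun i => nxt w i.+1) n = map succn (mkseq (nxt v) n).
  rewrite /mkseq -map_comp; apply: (@eq_in_mkseq _ _ (fun i => (nxt v i).+1)) => i i_n.
  rewrite nxt_catl ?nxt_map_succ ?(perm_iota_uniq vn) ?(perm_iota_mem vn) //.
    by rewrite map_inj_uniq ?(perm_iota_uniq vn) //; apply: succn_inj.
  by rewrite (mem_map succn_inj) (perm_iota_mem vn).
rewrite /w -cat_rcons cats1 [av132 (rcons (rcons _ _) _)]av132_rcons_min ?all_predT //.
rewrite av132_rcons_max // [av132 (rcons (_ :: _) _)]av132_rcons_min //; last first.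
  exact/allP.
rewrite av132_cons_max ?av132_map_succ ?(perm_iota_size vn) //.
rewrite all_map; apply: sub_all (perm_iota_mkseq_lt vn) => x /=; lia.
Qed.

(** * Decomposition of good words *)

(** When the maximum comes first, the running maximum is always [N] and never cuts off the next
    letter. *)
Lemma nxt_cyc N R p x y v : uniq (N :: R) -> all (leq^~ N) R ->
  N :: R = p ++ x :: y :: v -> nxt (N :: R) x = y.
Proof.
move=> uw mx E; have Nw : N \in rcons p x.
  by case: p E => [|a p] [-> _]; rewrite ?mem_head // rcons_cons mem_head.
have {}mx : all (leq^~ N) (p ++ x :: y :: v) by rewrite -E /= leqnn.
rewrite E in uw *; apply: nxt_next Nw _ _.
- by move: uw; rewrite cat_uniq => /and3P[_ /norP[]].
- by move: mx; rewrite -cat_rcons all_cat => /andP[].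
- by move: mx; rewrite all_cat /= => /and4P[].
Qed.

Lemma nxt_cyc_last N R x : uniq (N :: R) -> all (leq^~ N) R ->
  x = last N R -> nxt (N :: R) x = N.
Proof.
move=> + + ->; elim/last_ind: R => [|R y _] uw mx /=.
  by rewrite -[[:: N]]/(rcons [::] N) (@nxt_close _ _ N) ?mem_head //= leqnn.
rewrite last_rcons -rcons_cons; apply: nxt_close => /=.
- by move: uw; rewrite -rcons_cons rcons_uniq => /andP[].
- by rewrite mem_head.
- by rewrite leqnn.
Qed.

Lemma map_succ_pred (s : seq nat) : 0 \notin s -> map succn (map predn s) = s.
Proof.
move=> s0; rewrite -map_comp map_id_in // => x xs /=; apply: prednK.
by rewrite lt0n; apply: contra s0 => /eqP <-.
Qed.

(** Otherwise [x], [N], [y] would be an occurrence of 132. *)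
Lemma av132_cat_max L N R : uniq (L ++ N :: R) -> av132 (L ++ N :: R) ->
  all (leq^~ N) R -> forall x y, x \in L -> y \in R -> y < x.
Proof.
move=> uw /av132P av mx x y xL yR.
have /av : subseq [:: x; N; y] (L ++ N :: R).
  by apply: (@cat_subseq _ [:: x]); rewrite ?sub1seq //= eqxx sub1seq.
have yN := allP mx _ yR.
move: uw; rewrite cat_uniq /= => /and4P[_ /norP[NL /hasPn RL] NR _].
have xy : x != y by apply: contraTneq xL => ->; apply: RL.
have yN' : y != N by apply: contraNneq NR => <-.
move: yN => /=; lia.
Qed.

(** With [w = L N R], the cases are [R] empty, [R] a single letter and [L] empty. If [L] is nonempty
    and [R] has two letters or more, the word of the permutation contains 132. *)
Lemma good_split n w : perm_eq w (iota 0 n.+3) -> good w ->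
  [\/ exists2 v, perm_eq v (iota 0 n.+2) & w = rcons v n.+2,
      exists2 v, perm_eq v (iota 0 n.+1) & w = map succn v ++ [:: n.+2; 0]
    | head 0 w = n.+2].
Proof.
move=> wn /andP[avw]; rewrite (perm_iota_size wn).
set N := n.+2; set f := nxt w => avf.
have [L [R E]] : exists L R, w = L ++ N :: R.
  have : N \in w by rewrite (perm_iota_mem wn).
  by case/splitPr => L R; exists L, R.
have wlt x : x \in L ++ N :: R -> x < n.+3 by rewrite -E (perm_iota_mem wn).
have uw : uniq (L ++ N :: R) by rewrite -E (perm_iota_uniq wn).
have := uw; rewrite cat_uniq cons_uniq => /and3P[uL /norP[NL /hasPn RL] /andP[NR uR]].
have RN y : y \in R -> y < N.
  move=> yR; have := wlt y; rewrite mem_cat inE yR !orbT => /(_ isT).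
  by rewrite ltnS leq_eqVlt => /orP[/eqP yN|//]; case/negP: NR; rewrite /N -yN.
have LN y : y \in L -> y < N.
  move=> yL; have := wlt y; rewrite mem_cat yL => /(_ isT).
  by rewrite ltnS leq_eqVlt => /orP[/eqP yN|//]; case/negP: NL; rewrite /N -yN.
have RNa : all (leq^~ N) R by apply/allP => y /RN/ltnW.
have LNa : all (leq^~ N) L by apply/allP => y /LN/ltnW.
rewrite E in avw; have gt := av132_cat_max uw avw RNa.
case: L E uw uL NL RL LN LNa gt {avw} wlt => [|l L] E uw uL NL RL LN LNa gt wlt.
  by apply: Or33; rewrite E.
case/lastP: R E uw NR uR RN RNa gt {RL} wlt => [|R j] E uw NR uR RN RNa gt wlt.
  rewrite cats1 in E; apply: Or31; exists (l :: L) => //.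
  by rewrite -perm_iota_rcons -E.
have lL : l \in l :: L by exact: mem_head.
have L0 : 0 \notin l :: L.
  by apply/negP => /gt gt0; have := gt0 j; rewrite mem_rcons mem_head => /(_ isT).
have R0 : 0 \in rcons R j.
  have : 0 \in w by rewrite (perm_iota_mem wn).
  by rewrite E mem_cat (negPf L0) inE.
case/lastP: R E uw NR uR RN RNa gt wlt R0 => [|R p] E uw NR uR RN RNa gt wlt R0.
  apply: Or32; move: R0; rewrite mem_rcons mem_seq1 => /eqP j0; subst j.
  exists (map predn (l :: L)); last by rewrite map_succ_pred.
  by rewrite -perm_iota_map_cat map_succ_pred // -/N -E.
(* Now the part after [N] ends in the two letters [p], [j], and [l] is the first letter of [w]. *)
exfalso.
have wE : w = rcons ((l :: L) ++ N :: rcons R p) j by rewrite E rcons_cat.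
have jN : nxt w j = N.
  rewrite wE; apply: nxt_close.
  - by move: uw; rewrite -rcons_cons -rcons_cat rcons_uniq => /andP[].
  - by rewrite mem_rcons inE mem_cat mem_head !orbT.
  - by rewrite rcons_cat rcons_cons all_cat LNa /= leqnn.
have Rnext q x y r : rcons (rcons R p) j = q ++ x :: y :: r -> nxt w x = y.
  move=> Rq; rewrite E Rq -[N :: (q ++ _)]cat_cons catA.
  have uq : uniq (((l :: L) ++ N :: q) ++ x :: y :: r) by rewrite -catA [(N :: q) ++ _]cat_cons -Rq.
  apply: (@nxt_next _ _ _ _ N).
  - by move: uq; rewrite cat_uniq => /and3P[_ /norP[]].
  - by rewrite mem_rcons inE mem_cat mem_head !orbT.
  - move: RNa; rewrite Rq all_cat => /and3P[qN xN _].
    by rewrite all_rcons xN all_cat LNa /= leqnn.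
  - by apply: (allP RNa); rewrite Rq mem_cat !inE eqxx !orbT.
(* A letter before [N] is mapped to a letter before [N], since [N] opens a new cycle. *)
have flL : nxt w l \in l :: L.
  by rewrite E nxt_catl // nxt_mem.
have lN := LN l lL; have flN := LN _ flL.
have jl : j < l by apply: gt => //; rewrite mem_rcons mem_head.
(* If [j = 0], the positions [p < l < N] carry 132: [p] goes to 0, [N] to a nonzero letter on its
   right, and [l] to a letter left of [N], which is larger. *)
case: (posnP j) => [j0|j0].
  have p0 : nxt w p = 0.
    by apply: (Rnext R p 0 [::]); rewrite j0 -!cats1 -catA.
  have pR : p \in rcons (rcons R p) j by rewrite !mem_rcons inE mem_rcons mem_head orbT.
  have fN : 0 < nxt w N /\ nxt w N \in rcons (rcons R p) j.
    have [y [r Ry y0]] : exists y, exists2 r, rcons (rcons R p) j = y :: r & 0 < y.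
      move: uR; rewrite rcons_uniq mem_rcons inE j0.
      case: (R) => [|y r] /=; rewrite ?inE => /andP[/norP[py yr] _].
        by exists p, [:: 0] => //; rewrite lt0n eq_sym.
      by exists y, (rcons (rcons r p) 0); rewrite // lt0n eq_sym; case/norP: yr.
    rewrite E Ry (@nxt_next _ _ _ _ N) ?mem_head //.
    - by rewrite mem_rcons mem_head.
    - by rewrite all_rcons leqnn.
    - by apply: (allP RNa); rewrite Ry mem_head.
  have := av132_mkseq avf (gt _ _ lL pR) lN (leqnn _).
  have := gt _ _ flL fN.2; rewrite /f p0; move: fN.1; clear; lia.
(* If [j] is positive, 0 is followed by some [y] right of [N], and the positions [0 < j < l] carry
   [y], [N] and a letter left of [N]. *)
have {}R0 : 0 \in rcons R p by move: R0; rewrite mem_rcons inE eq_sym eqn0Ngt j0.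
have [y [q [r Ry]]] : exists y q r, rcons (rcons R p) j = q ++ 0 :: y :: r.
  case/splitPr: R0 => q [|y r]; rewrite rcons_cat /=; first by exists j, q, [::].
  by exists y, q, (rcons r j).
have f0 := Rnext _ _ _ _ Ry.
have := av132_mkseq avf j0 jl (ltnW lN).
have : y < nxt w l by apply: gt => //; rewrite Ry mem_cat !inE eqxx !orbT.
rewrite /f f0 jN; move: flN; clear; lia.
Qed.

(* A cycle word starts with its largest letter when there is only one cycle. *)
Definition cyclic_words n := [seq w <- good_words n | head 0 w == n.-1].

Lemma mem_good_words n w :
  (w \in good_words n) = perm_eq w (iota 0 n) && good w.
Proof. by rewrite mem_filter mem_permutations andbC. Qed.

Lemma good_words_uniq n : uniq (good_words n).
Proof. by rewrite filter_uniq ?permutations_uniq. Qed.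

Lemma mem_cyclic_words n w : (w \in cyclic_words n) =
  [&& perm_eq w (iota 0 n), good w & head 0 w == n.-1].
Proof. by rewrite mem_filter mem_good_words andbC andbA. Qed.

Lemma good_words_rec n : perm_eq (good_words n.+3)
  ([seq rcons v n.+2 | v <- good_words n.+2] ++
   [seq map succn v ++ [:: n.+2; 0] | v <- good_words n.+1] ++
   cyclic_words n.+3).
Proof.
have inj2 : injective (fun v => map succn v ++ [:: n.+2; 0]).
  move=> u v /=; rewrite -!(cat_rcons n.+2) !cats1 => /rcons_inj[/rcons_inj[]].
  by apply: inj_map; apply: succn_inj.
apply: uniq_perm; first exact: good_words_uniq.
  rewrite !cat_uniq; apply/and5P; split.
  - rewrite map_inj_uniq ?good_words_uniq //; exact: (@rcons_injl _ n.+2).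
  - apply/hasPn => w; rewrite mem_cat => /orP[/mapP[v _ ->]|].
      by apply/mapP => -[u _ /(congr1 (last 0))]; rewrite last_cat last_rcons.
    rewrite mem_cyclic_words => /and3P[_ _ /eqP hw].
    apply/mapP => -[v]; rewrite mem_good_words => /andP[vn _] wE.
    case: v vn wE hw => [/perm_size//|x v] vn -> /= xE.
    by have := perm_iota_mem vn x; rewrite mem_head xE ltnn.
  - by rewrite map_inj_uniq ?good_words_uniq.
  - apply/hasPn => w; rewrite mem_cyclic_words => /and3P[_ _ /eqP hw].
    apply/mapP => -[v]; rewrite mem_good_words => /andP[vn _] wE.
    case: v vn wE hw => [/perm_size//|x v] vn -> /= [xE].
    by have := perm_iota_mem vn x; rewrite mem_head xE ltnn.
  - by rewrite filter_uniq ?good_words_uniq.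
move=> w; rewrite !mem_cat mem_cyclic_words mem_good_words.
apply/idP/idP => [/andP[wn gw]|/or3P[/mapP[v]|/mapP[v]|/and3P[-> ->]//]].
- case: (good_split wn gw) => [[v vn wE]|[v vn wE]|hw].
  + apply/orP; left; apply/mapP; exists v => //.
    by rewrite mem_good_words vn -(good_rcons vn) -wE.
  + apply/orP; right; apply/orP; left; apply/mapP; exists v => //.
    by rewrite mem_good_words vn -(good_map_cat vn) -wE.
  + by rewrite wn gw hw eqxx !orbT.
- by rewrite mem_good_words => /andP[vn gv] ->; rewrite perm_iota_rcons vn good_rcons.
- by rewrite mem_good_words => /andP[vn gv] ->; rewrite perm_iota_map_cat vn good_map_cat.
Qed.

(** * Cyclic words *)

Lemma perm_iota_cons_le n R : perm_eq (n :: R) (iota 0 n.+1) -> all (leq^~ n) R.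
Proof.
by rewrite perm_iota_cons => Rn; apply/allP => x; rewrite (perm_iota_mem Rn) => /ltnW.
Qed.

(** If [s] lists the values at [1, ..., n], the permutation words are [n+1, s, n] and [n, s]; each
    avoids 132 exactly when [s] does. *)
Lemma good_cons n v : perm_eq (n :: v) (iota 0 n.+1) -> last n v = 0 ->
  good [:: n.+1, n & v] = good (n :: v).
Proof.
move=> vn v0; set w := n.+1 :: _.
have wn : perm_eq w (iota 0 n.+2) by rewrite perm_iota_cons.
have [vle wle] := (perm_iota_cons_le vn, perm_iota_cons_le wn).
have [uv uw] := (perm_iota_uniq vn, perm_iota_uniq wn).
rewrite /good av132_cons_max // (perm_iota_size wn) (perm_iota_size vn).
rewrite mkseqS mkseq_recl [mkseq _ n.+1]mkseq_recl.
have -> : nxt w 0 = n.+1 by apply: nxt_cyc_last.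
have -> : nxt w n.+1 = n by apply: (@nxt_cyc _ _ [::] _ _ v).
have -> : nxt (n :: v) 0 = n by apply: nxt_cyc_last.
have -> : mkseq (fun i => nxt w i.+1) n = mkseq (fun i => nxt (n :: v) i.+1) n.
  apply: eq_in_mkseq => i i_n.
  have [p [q E]] : exists p q, n :: v = p ++ i.+1 :: q.
    have : i.+1 \in n :: v by rewrite (perm_iota_mem vn).
    by case/splitPr => p q; exists p, q.
  (* As the last letter is 0, [i.+1] has a successor, the same in both words. *)
  case: q E => [|y q] E.
    by have := congr1 (last 0) E; rewrite /= v0 last_cat.
  rewrite (nxt_cyc uv vle E) (@nxt_cyc _ _ (n.+1 :: p) _ y q) //.
  by rewrite E.
set s := mkseq _ n.
have sn : all (leq^~ n) s.
  apply/allP => _ /mapP[x + ->]; rewrite mem_iota => xn.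
  by rewrite -ltnS; apply: perm_iota_nxt vn _ _; lia.
rewrite rcons_cons !av132_cons_max ?av132_rcons_max //.
rewrite all_rcons leqW //; apply: sub_all sn => x /=; lia.
Qed.

(** If the old permutation word is [s, b], the new one is [n+2], the shift of [s], then [0, b+1].
    Neither the leading maximum nor the 0 before the last letter matters for avoidance. *)
Lemma good_insert n v : perm_eq (n :: v) (iota 0 n.+1) ->
  good (n.+2 :: map succn v ++ [:: n.+1; 0]) = good (n :: v).
Proof.
move=> vn; set w := n.+2 :: _.
have wn : perm_eq w (iota 0 n.+3).
  by rewrite perm_iota_cons perm_iota_map_cat -perm_iota_cons.
have [vle wle] := (perm_iota_cons_le vn, perm_iota_cons_le wn).
have [uv uw] := (perm_iota_uniq vn, perm_iota_uniq wn).
rewrite /good (perm_iota_size wn) (perm_iota_size vn).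
(* This splits off the positions 0, [n.+1] and [n.+2] for [w], and the position [n] for [n :: v]. *)
rewrite !(mkseqS (nxt w)) -(mkseqS (nxt w)) mkseq_recl mkseqS.
have -> : nxt w 0 = n.+2 by apply: nxt_cyc_last; rewrite // last_cat.
have -> : nxt w n.+1 = 0.
  by apply: (@nxt_cyc _ _ (n.+2 :: map succn v) _ _ [::]).
have -> : nxt w n.+2 = (nxt (n :: v) n).+1.
  case: (v) @w uv uw vle wle {vn wn} => [|y v'] w uv uw vle wle.
    rewrite (@nxt_cyc_last n) // (@nxt_cyc _ _ [::] _ n.+1 [:: 0]) //.
  rewrite (@nxt_cyc n _ [::] _ y v') //.
  by rewrite (@nxt_cyc _ _ [::] _ y.+1 (map succn v' ++ [:: n.+1; 0])).
have -> : mkseq (fun i => nxt w i.+1) n = map succn (mkseq (nxt (n :: v)) n).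
  rewrite /mkseq -map_comp.
  apply: (@eq_in_mkseq _ _ (fun i => (nxt (n :: v) i).+1)) => i i_n.
  have [p [q E]] : exists p q, v = p ++ i :: q.
    have : i \in v by have := vn; rewrite perm_iota_cons => /perm_iota_mem ->.
    by case/splitPr => p q; exists p, q.
  case: q E => [|y q] E.
    rewrite (@nxt_cyc_last n) //; last by rewrite E last_cat.
    rewrite (@nxt_cyc _ _ (n.+2 :: map succn p) _ n.+1 [:: 0]) //.
    by rewrite E map_cat /= -catA.
  rewrite (@nxt_cyc n _ (n :: p) _ y q) ?E //; last by rewrite -E.
    rewrite (@nxt_cyc _ _ (n.+2 :: map succn p) _ y.+1 (map succn q ++ [:: n.+1; 0])) //.
    by rewrite E map_cat /= -catA.
  by rewrite -E.
set s := mkseq _ n; set b := nxt _ n.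
have sn : all (leq^~ n) s.
  apply/allP => _ /mapP[x + ->]; rewrite mem_iota => xn.
  by rewrite -ltnS; apply: perm_iota_nxt vn _ _; lia.
have bn : b <= n by rewrite -ltnS; apply: perm_iota_nxt vn _ _.
congr (_ && _).
  rewrite av132_cons_max // -cat_rcons cats1 av132_rcons_min; last exact/allP.
  rewrite av132_rcons_max; last by rewrite all_map.
  by rewrite av132_map_succ [RHS]av132_cons_max.
rewrite !rcons_cons av132_cons_max.
  by rewrite -cats1 cat_rcons av132_cat0 -map_rcons av132_map_succ.
rewrite !all_rcons /= all_map; apply/andP; split; first by lia.
by apply: sub_all sn => x /=; lia.
Qed.

(** The permutation word is [1, 2, ..., n, 0], increasing up to its final 0. *)
Lemma good_rotation n : good (n :: iota 0 n).
Proof.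
set w := n :: _.
have wn : perm_eq w (iota 0 n.+1) by rewrite perm_iota_cons.
have wle := perm_iota_cons_le wn; have uw := perm_iota_uniq wn.
rewrite /good av132_cons_max // av132_iota (perm_iota_size wn) mkseqS.
have -> : mkseq (nxt w) n = mkseq succn n.
  apply: eq_in_mkseq => i i_n.
  case: (ltnP i.+1 n) => i1n.
    apply: (@nxt_cyc _ _ (n :: iota 0 i) _ _ (iota i.+2 (n - i.+2))) => //.
    rewrite cat_cons; congr (_ :: _).
    by rewrite -[in LHS](subnKC (ltnW i_n)) iotaD; congr (_ ++ _);
       rewrite [RHS](_ : _ = iota i (n - i.+2).+2) //; congr iota; lia.
  have E : i.+1 = n by lia.
  rewrite E; apply: nxt_cyc_last => //.
  by rewrite -E -addn1 iotaD last_cat.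
have -> : mkseq succn n = iota 1 n by rewrite /mkseq -(addn0 1) iotaDl.
have -> : nxt w n = 0.
  by case: n @w {wn} wle uw => [|n] w wle uw;
     [apply: nxt_cyc_last | apply: (@nxt_cyc _ _ [::] _ _ (iota 1 n))].
rewrite av132_rcons_min ?av132_iota //; exact/allP.
Qed.

(** The last letter decides. If it is 0, the position of [n.+1] in [R] gives the last two cases;
    otherwise [R] is shown to start with 0 and to increase. *)
Lemma cyclic_split n R : perm_eq (n.+2 :: R) (iota 0 n.+3) ->
  good (n.+2 :: R) ->
  [\/ R = iota 0 n.+2,
      exists2 v, perm_eq (n.+1 :: v) (iota 0 n.+2) /\ last n.+1 v = 0
               & R = n.+1 :: v
    | exists2 v, perm_eq (n :: v) (iota 0 n.+1) & R = map succn v ++ [:: n.+1; 0]].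
Proof.
set N := n.+2; set w := N :: R => wn /andP[]; rewrite (perm_iota_size wn).
have wle := perm_iota_cons_le wn; have uw := perm_iota_uniq wn.
rewrite av132_cons_max // => avR avf.
have Rn : perm_eq R (iota 0 N) by rewrite -perm_iota_cons.
have uR := perm_iota_uniq Rn; have Rm := perm_iota_mem Rn.
set f := nxt w in avf.
case: (eqVneq (last N R) 0) => [R0|j0].
  have [L [R' E]] : exists L R', R = L ++ n.+1 :: R'.
    have : n.+1 \in R by rewrite Rm.
    by case/splitPr => L R'; exists L, R'.
  case: L E => [|l L] E.
    apply: Or32; exists R' => //; split; first by rewrite -[_ :: R']/([::] ++ _) -E.
    by move: R0; rewrite E.
  case/lastP: R' E => [|R' j] E.
    by move: R0; rewrite E last_cat.
  have {}R0 : j = 0 by move: R0; rewrite E last_cat /= last_rcons.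
  subst j; case/lastP: R' E => [|R' p] E.
    have L0 : 0 \notin l :: L.
      move: uR; rewrite E cat_uniq => /and3P[_ /hasPn uh _].
      by apply: uh; rewrite !inE.
    apply: Or33; exists (map predn (l :: L)); last by rewrite map_succ_pred.
    by rewrite perm_iota_cons -perm_iota_map_cat map_succ_pred // -[_ ++ _]E.
  (* Letters before [n.+1] exceed those after it. With [i] the letter just before [n.+1] and [p] the
     one before the final 0, the positions [p < i < N] carry [0, n+1, l]. *)
  exfalso.
  have gt : forall x y, x \in l :: L -> y \in rcons (rcons R' p) 0 -> y < x.
    apply: (@av132_cat_max _ n.+1); rewrite -?E //.
    apply/allP => y yR; rewrite -ltnS -/N -Rm E mem_cat.
    by rewrite [y \in _ :: rcons _ _]in_cons yR !orbT.
  have i0L : last l L \in l :: L by apply: mem_last.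
  have fi : f (last l L) = n.+1.
    apply: (@nxt_cyc _ _ (N :: belast l L) _ _ (rcons (rcons R' p) 0)) => //.
    by rewrite E (lastI l) cat_rcons.
  have fp : f p = 0.
    apply: (@nxt_cyc _ _ (N :: (l :: L) ++ n.+1 :: R') _ _ [::]) => //.
    by rewrite E /= -catA /= -!cats1 -catA.
  have fN : f N = l.
    by apply: (@nxt_cyc _ _ [::] _ _ (L ++ n.+1 :: rcons (rcons R' p) 0)) => //; rewrite E.
  have pi : p < last l L.
    by apply: gt => //; rewrite !mem_rcons inE mem_rcons mem_head orbT.
  have iN : last l L < N by rewrite -Rm E mem_cat i0L.
  have l0 : 0 < l by apply: gt; rewrite ?mem_head // mem_rcons mem_head.
  have ln : l < n.+1.
    have : l < N by rewrite -Rm E mem_head.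
    move: uR; rewrite E cat_cons cons_uniq mem_cat inE => /andP[/norP[_ /norP[ln _]] _].
    by rewrite /N; move: ln; clear; lia.
  have := av132_mkseq avf pi iN (leqnn _); by rewrite fi fp fN l0 ln.
set j := last N R in j0.
have jR : j \in R.
  by rewrite /j; case: (R) Rn => [/perm_size//|a s] _; apply: mem_last.
have fj : f j = N by apply: nxt_cyc_last.
have [u [v E]] : exists u v, R = u ++ 0 :: v.
  have : 0 \in R by rewrite Rm.
  by case/splitPr => u v; exists u, v.
(* A descent after 0 would complete 0 to a 132. *)
have vs : sorted leq v.
  apply: pairwise_sorted; apply/pairwise_subseqP => b c bc.
  have : subseq [:: 0; b; c] R.
    by rewrite E; apply: (@cat_subseq _ [::] (0 :: [:: b; c])); rewrite ?sub0seq //= bc.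
  move=> sbc; have := av132P _ avR _ _ _ sbc.
  have : 0 \notin v by move: uR; rewrite E cat_uniq /= => /and4P[].
  have cv : c \in v by apply: (mem_subseq bc); rewrite !inE eqxx orbT.
  by move=> v0; have c0 : c != 0 by [apply: contraNneq v0 => <-]; move: c0; clear; lia.
case: u E => [|h u] E.
  apply: Or31; apply: (sorted_eq leq_trans anti_leq) => //; last exact: iota_sorted.
  rewrite E /=; case: (v) vs => //.
(* Suppose [h] follows [N] and is not 0. With [m] the letter before 0, the aim is [j < m], then
   [j < h], then a 132 at the positions [0 < j < N]. *)
exfalso.
case: v E vs => [|y v] E vs.
  by case/eqP: j0; rewrite /j E last_cat.
have jE : j = last y v by rewrite /j E last_cat.
have f0 : f 0 = y.
  by apply: (@nxt_cyc _ _ (N :: (h :: u)) _ _ v) => //; rewrite E.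
have fN : f N = h.
  by apply: (@nxt_cyc _ _ [::] _ _ (u ++ [:: 0, y & v])) => //; rewrite E.
have yj : y <= j.
  rewrite jE; case/lastP: (v) vs => // v' z; rewrite last_rcons => /order_path_min.
  by move=> /(_ leq_trans)/allP; apply; rewrite mem_rcons mem_head.
have hlt : h < N by rewrite -Rm E mem_head.
have jlt : j < N by rewrite -Rm.
have jv : j \in y :: v by rewrite jE mem_last.
have uq x : x \in h :: u -> x != j.
  move=> xu; apply: contraTneq jv => <-; apply/negP => xv.
  move: uR; rewrite E cat_uniq => /and3P[_ /hasPn/(_ x)].
  by rewrite in_cons xv orbT => /(_ isT); rewrite /= xu.
set m := last h u.
have fm : f m = 0.
  apply: (@nxt_cyc _ _ (N :: belast h u) _ _ (y :: v)) => //.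
  by rewrite E (lastI h) cat_rcons.
have h0 : 0 < h.
  by move: uR; rewrite E /= mem_cat inE => /andP[/norP[_ /norP[h0 _]] _]; rewrite lt0n.
have mj : j < m.
  case: (ltngtP m j) => [mj|//|mj]; last by have := uq m (mem_last _ _); rewrite mj eqxx.
  (* If [m < j], the positions [m < j < N] carry [0, N, h]. *)
  have := av132_mkseq avf mj jlt (leqnn _); by rewrite fm fN fj h0 hlt.
have hj : j < h.
  case: (ltngtP h j) => [hj|//|hj]; last by have := uq h (mem_head _ _); rewrite hj eqxx.
  have hm : h != m by apply: contraTneq hj => ->; rewrite -leqNgt ltnW.
  (* If [h < j], then [h < j < m], and [h, m, j] is a 132 in [R] itself. *)
  have : subseq [:: h; m; j] R.
    rewrite E -[[:: h; m; j]]/([:: h; m] ++ [:: j]); apply: cat_subseq.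
      rewrite /= eqxx sub1seq; move: hm; rewrite /m; case: (u) => [|a s]; rewrite /= ?eqxx //.
      by rewrite mem_last.
    by rewrite sub1seq inE jv orbT.
  by move/(av132P _ avR); rewrite hj mj.
(* The positions [0 < j < N] carry [y, N, h], where [y <= j < h]. *)
rewrite -lt0n in j0; have := av132_mkseq avf j0 jlt (leqnn _).
by rewrite f0 fN fj hlt (leq_ltn_trans yj hj).
Qed.

(** The class on which a new maximum can be put in front by [good_cons]. *)
Definition cyclic_words0 n := [seq w <- cyclic_words n | last 0 w == 0].

(** * Enumeration *)

Lemma cyclic_wordsP n w :
  reflect (exists2 R, w = n :: R & perm_eq w (iota 0 n.+1) && good w)
          (w \in cyclic_words n.+1).
Proof.
rewrite mem_cyclic_words; apply: (iffP and3P) => [[wn gw]|[R -> /andP[-> ->]]].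
  case: w wn gw => [/perm_size//|a R] wn gw /eqP aE.
  by rewrite /= in aE; subst a; exists R; rewrite ?wn.
by rewrite [head _ _]/= eqxx.
Qed.

Lemma cyclic_words_uniq n : uniq (cyclic_words n).
Proof. by rewrite filter_uniq ?good_words_uniq. Qed.

Lemma cyclic_words0_uniq n : uniq (cyclic_words0 n).
Proof. by rewrite filter_uniq ?cyclic_words_uniq. Qed.

Lemma mem_cyclic_words0 n w :
  (w \in cyclic_words0 n) = (last 0 w == 0) && (w \in cyclic_words n).
Proof. exact: mem_filter. Qed.

Lemma last_iota x n : last x (iota 0 n.+1) = n.
Proof. by rewrite -addn1 iotaD last_cat. Qed.

(** Among the forms in [cyclic_split], only the rotation does not end in 0. *)
Lemma cyclic_words_rec n : perm_eq (cyclic_words n.+3)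
  ((n.+2 :: iota 0 n.+2) :: cyclic_words0 n.+3).
Proof.
apply: uniq_perm; first exact: cyclic_words_uniq.
  by rewrite cons_uniq cyclic_words0_uniq mem_cyclic_words0 last_cons last_iota.
move=> w; rewrite in_cons mem_cyclic_words0.
apply/idP/idP => [wC|/orP[/eqP ->|/andP[_ ->] //]]; last first.
  by apply/cyclic_wordsP; exists (iota 0 n.+2); rewrite // good_rotation perm_iota_cons perm_refl.
have /cyclic_wordsP[R wE /andP[wn gw]] := wC; rewrite wC andbT.
rewrite {}wE in wn gw *.
have [->|[v [_ v0] ->]|[v _ ->]] := cyclic_split wn gw; first by rewrite eqxx.
  by rewrite /= v0 eqxx orbT.
by rewrite /= last_cat eqxx orbT.
Qed.

(** The second letter is [n.+2] in the first family only. In the second, [behead] drops the old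
    leading maximum, which reappears shifted before the final 0. *)
Lemma cyclic_words0_rec n : perm_eq (cyclic_words0 n.+4)
  ([seq n.+3 :: v | v <- cyclic_words0 n.+3] ++
   [seq n.+3 :: map succn (behead v) ++ [:: n.+2; 0] | v <- cyclic_words n.+2]).
Proof.
apply: uniq_perm; first exact: cyclic_words0_uniq.
  rewrite cat_uniq; apply/and3P; split.
  - by rewrite map_inj_uniq ?cyclic_words0_uniq // => u v [].
  - apply/hasPn => _ /mapP[_ /cyclic_wordsP[v -> /andP[vn _]] ->] /=.
    apply/mapP => -[u]; rewrite mem_cyclic_words0 => /andP[_ /cyclic_wordsP[R -> _]] [].
    case: v vn => [/perm_size//|x v vn] /= [xE _].
    by have := perm_iota_uniq vn; rewrite xE cons_uniq mem_head.
  - rewrite map_inj_in_uniq ?cyclic_words_uniq //.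
    move=> _ _ /cyclic_wordsP[u -> _] /cyclic_wordsP[v -> _] [] /=.
    rewrite -!(cat_rcons n.+2) !cats1 => /rcons_inj[/rcons_inj[/inj_map uv]].
    by rewrite uv //; apply: succn_inj.
move=> w; rewrite mem_cyclic_words0 mem_cat.
apply/idP/idP => [/andP[w0 /cyclic_wordsP[R wE /andP[wn gw]]]|/orP[]].
- rewrite {}wE in w0 wn gw *.
  have [E|[v [vn v0] E]|[v vn E]] := cyclic_split wn gw.
  + by move: w0; rewrite E last_cons last_iota.
  + apply/orP; left; rewrite E map_f // mem_cyclic_words0 /= v0 eqxx.
    by apply/cyclic_wordsP; exists v; rewrite // vn -(good_cons vn v0) -E.
  + apply/orP; right; apply/mapP; exists (n.+1 :: v); last by rewrite E.
    by apply/cyclic_wordsP; exists v; rewrite // vn -(good_insert vn) -E.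
- move=> /mapP[v]; rewrite mem_cyclic_words0 => /andP[v0 /cyclic_wordsP[R vE /andP[vn gv]]] ->.
  rewrite {}vE in v0 vn gv *; rewrite [last _ _ == 0]v0.
  apply/cyclic_wordsP; exists (n.+2 :: R) => //.
  by rewrite perm_iota_cons vn good_cons //; apply/eqP.
- move=> /mapP[_ /cyclic_wordsP[v -> /andP[vn gv]] ->] /=; rewrite last_cat eqxx.
  apply/cyclic_wordsP; exists (map succn v ++ [:: n.+2; 0]) => //.
  by rewrite good_insert // gv perm_iota_cons perm_iota_map_cat -perm_iota_cons vn.
Qed.

(** The rotation adds 1 to the count of words ending in 0 at every length from 3 on, so it turns the
    previous such count into the previous full count and leaves the Fibonacci recurrence. *)
Lemma size_cyclic_words n : size (cyclic_words n.+2) = fib n.+2.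
Proof.
suff : size (cyclic_words n.+2) = fib n.+2 /\ size (cyclic_words n.+3) = fib n.+3.
  by case.
elim: n => [|n [IH2 IH3]]; first by split; vm_compute.
split=> //; rewrite (perm_size (cyclic_words_rec _)) [LHS]/= (perm_size (cyclic_words0_rec _)).
rewrite size_cat !size_map IH2 [fib n.+4]/(fib n.+3 + fib n.+2) -IH3.
by rewrite (perm_size (cyclic_words_rec _)).
Qed.

Lemma size_good_words_rec n : size (good_words n.+3) =
  size (good_words n.+2) + size (good_words n.+1) + fib n.+3.
Proof.
by rewrite (perm_size (good_words_rec n)) !size_cat !size_map size_cyclic_words addnA.
Qed.

Lemma fibS n : fib n.+2 = fib n.+1 + fib n.
Proof. by []. Qed.

Definition fib_conv n := \sum_(0 <= k < n.+2) fib (n.+1 - k) * fib k.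

(** The top term vanishes with [fib 0], the next one is [fib n.+2], and in the others the Fibonacci
    recurrence applies to the first factor. *)
Lemma fib_conv_rec n : fib_conv n.+2 = fib_conv n.+1 + fib_conv n + fib n.+2.
Proof.
rewrite /fib_conv big_nat_recr //= subnn mul0n addn0 big_nat_recr //=.
rewrite (_ : n.+3 - n.+2 = 1) ?mul1n; last by lia.
congr (_ + _); rewrite [in RHS]big_nat_recr //= subnn mul0n addn0 -big_split /=.
apply: eq_big_nat => k /andP[_ kn]; rewrite -mulnDl; congr (_ * _).
have -> : n.+3 - k = (n.+1 - k).+2 by lia.
by have -> : n.+2 - k = (n.+1 - k).+1 by lia.
Qed.

Lemma t_num132_fib n : t_num [:: 1; 3; 2] n.+1 = fib_conv n.+1.
Proof.
rewrite t_num132E.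
suff : size (good_words n.+1) = fib_conv n.+1 /\ size (good_words n.+2) = fib_conv n.+2.
  by case.
elim: n => [|n [IH1 IH2]].
  by rewrite /fib_conv /index_iota unlock; split; vm_compute.
by split=> //; rewrite size_good_words_rec fib_conv_rec IH1 IH2.
Qed.

(** * Generating function *)

Import GRing.Theory.
Local Open Scope ring_scope.

(** In the [n]-th coefficient of both products the terms with earlier coefficients agree by
    induction; the remaining factor [f 0] cancels. *)
Lemma fps_inv_unique (F : fieldType) (f b : fps F) : f 0%N != 0 ->
  fps_mul f b =1 fps_of_poly 1 -> fps_inv f =1 b.
Proof.
move=> f0 fb n; elim/ltn_ind: n => n IHn.
have := fps_mulV f0 n; rewrite -(fb n) /fps_mul !big_ord_recl /= subn0.
rewrite (eq_bigr (fun i : 'I_n => f (bump 0 i) * b (n - bump 0 i)%N)) => [|i _].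
  by move/addIr/(mulfI f0).
by rewrite IHn // /bump; have := ltn_ord i; lia.
Qed.

Lemma coef_denominator (F : fieldType) n :
  (((1 - 'X - 'X ^+ 2) ^+ 2 : {poly F})`_n) = [:: 1; -2; -1; 2; 1]`_n.
Proof.
have -> : (1 - 'X - 'X ^+ 2) ^+ 2 = Poly [:: 1; -2; -1; 2; 1] :> {poly F}.
  rewrite /= !cons_poly_def !polyCN polyC1 [2%:P]polyC_natr; ring.
by rewrite coef_Poly.
Qed.

Lemma fib_conv_inverse :
  fps_mul (fps_of_poly ((1 - 'X - 'X ^+ 2) ^+ 2)) (fun n => (fib_conv n.+1)%:R : rat)
    =1 fps_of_poly 1.
Proof.
move=> n; rewrite /fps_mul /fps_of_poly coef1.
under eq_bigr do rewrite coef_denominator.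
have [c1 c2] : fib_conv 1 = 1%N /\ fib_conv 2 = 2%N.
  by rewrite /fib_conv /index_iota unlock.
have c3 : fib_conv 3 = 5%N by rewrite fib_conv_rec c1 c2.
have c4 : fib_conv 4 = 10%N by rewrite fib_conv_rec c2 c3.
case: n => [|[|[|[|n]]]].
1-4: by rewrite !big_ord_recl big_ord0 /= ?subSS ?subn0 ?c4 ?c3 ?c2 ?c1; ring.
(* From degree 4 on all five coefficients of the denominator take part, and the recurrences reduce
   the sum to a ring identity. *)
do 5 rewrite big_ord_recl; rewrite big1 => [|i _]; last by rewrite nth_default ?mul0r.
rewrite /= !subSS !subn0 !fib_conv_rec !fibS !natrD; ring.
Qed.

Theorem theorem3p2 :
  (forall n : nat, (1 <= n)%N ->
     t_num [:: 1; 3; 2]%N n = (\sum_(0 <= k < n.+2) fib (n.+1 - k) * fib k)%N)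
  /\
  (fun n : nat => if (1 <= n)%N then (t_num [:: 1; 3; 2]%N n)%:R else 0 : rat)
    =1 fps_div (fps_of_poly 'X)
               (fps_of_poly ((1 - 'X - 'X ^+ 2) ^+ 2)).
Proof.
split=> [[//|n] _|n]; first exact: t_num132_fib.
rewrite /fps_div /fps_mul /fps_of_poly.
case: n => [|n]; first by rewrite big_ord1 coefX mul0r.
(* Only the index 1 survives in the product with ['X], which shifts the inverse series by one. *)
rewrite big_ord_recl coefX mul0r add0r big_ord_recl coefX mul1r big1 => [|i _].
  rewrite addr0 subn1 t_num132_fib (fps_inv_unique _ fib_conv_inverse) //.
  by rewrite /fps_of_poly coef_denominator oner_eq0.
by rewrite coefX mul0r.
Qed.
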